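(* Let $X$ and $Y$ be second countable locally compact Hausdorff spaces. Let $(f_i\colon A_i\to Y)_{i\in\mathbb N}$ be a sequence in $\mathrm{Fell}(X,Y)$ and let $(f\colon A\to Y)\in\mathrm{Fell}(X,Y)$, where $A_i,A\subseteq X$ are the domains. Then $f_i\to f$ in $\mathrm{Fell}(X,Y)$ if and only if both of the following hold: (a) for all strictly increasing sequences of indices $i_j$, if $x_j\in A_{i_j}$ and both $x_j$ and $f_{i_j}(x_j)$ converge as $j\to\infty$, then $\lim_j x_j\in A$ and $f(\lim_j x_j)=\lim_j f_{i_j}(x_j)$; and (b) for all $x\in A$ there is a sequence $x_i\in A_i$ (one point for every index $i$) such that $x_i\to x$ and $f_i(x_i)$ converges. If in addition $Y$ is compact, then $f_i\to f$ in $\mathrm{Fell}(X,Y)$ if and only if both of the following hold: (c) for all strictly increasing sequences of indices $i_j$, if $x_j\in A_{i_j}$ and $x_j$ converges as $j\to\infty$, then $\lim_j x_j\in A$ and $f(\lim_j x_j)=\lim_j f_{i_j}(x_j)$ (the existence of the last limit being part of the assertion); and (d) for all $x\in A$ there is a sequence $x_i\in A_i$ (one point for every index $i$) such that $x_i\to x$.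
   Context: For a topological space $Z$, $2^Z$ is the set of all subsets of $Z$. The lower Vietoris topology on $2^Z$ is generated by (has as subbase) the sets $\{C\subseteq Z : C\cap U\neq\emptyset\}$ with $U\subseteq Z$ open. The upper co-compact topology on $2^Z$ is generated by the sets $\{C\subseteq Z : C\cap K=\emptyset\}$ with $K\subseteq Z$ compact. The Fell topology is the join of these two topologies (the coarsest topology containing both), and $\mathrm{Fell}(Z)$ is the set of closed subsets of $Z$ with the (subspace) Fell topology. A partial map from $X$ to $Y$ is a function $f\colon A\to Y$ whose domain $A$ is a subset of $X$. $\mathrm{Fell}(X,Y)$ is the set of partial maps from $X$ to $Y$ whose graph $\{(x,f(x)) : x\in A\}$ is a closed subset of $X\times Y$, with the subspace topology obtained by identifying a partial map with its graph, regarded as an element of $\mathrm{Fell}(X\times Y)$.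
   Formalization: In (b) and (d), ''x_i in A_i for every index i'' is replaced by: all but finitely many A_i are nonempty and x_i lies in A_i whenever A_i is nonempty; the literal form fails if, e.g., A_0 is empty and f_i = f with A nonempty for i ≥ 1. *)

(* Defs.v *)
From HB Require Import structures.
From mathcomp Require Import all_boot.
From mathcomp Require Import all_classical topology.

Set Implicit Arguments.
Unset Strict Implicit.
Unset Printing Implicit Defensive.

Local Open Scope classical_set_scope.

(* Type aliases of [set Z], so that each can carry its own topology. *)
Definition lower_vietoris (Z : topologicalType) : Type := set Z.

HB.instance Definition _ (Z : topologicalType) :=
  Choice.copy (lower_vietoris Z) (set Z).
HB.instance Definition _ (Z : topologicalType) :=
  @isSubBaseTopological.Build (lower_vietoris Z) (set Z)
    open (fun U => [set C : set Z | C `&` U !=set0]).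

Definition upper_cocompact (Z : topologicalType) : Type := set Z.

HB.instance Definition _ (Z : topologicalType) :=
  Choice.copy (upper_cocompact Z) (set Z).
HB.instance Definition _ (Z : topologicalType) :=
  @isSubBaseTopological.Build (upper_cocompact Z) (set Z)
    compact (fun K => [set C : set Z | C `&` K = set0]).

Definition fell_powerset (Z : topologicalType) : Type :=
  @sup_topology (set Z) bool (fun b =>
    if b then Topological.on (lower_vietoris Z)
    else Topological.on (upper_cocompact Z)).

HB.instance Definition _ (Z : topologicalType) :=
  Topological.copy (fell_powerset Z)
    (@sup_topology (set Z) bool (fun b =>
      if b then Topological.on (lower_vietoris Z)
      else Topological.on (upper_cocompact Z))).

Definition fell (Z : topologicalType) : Type :=
  set_type ([set C : set Z | closed C] : set (fell_powerset Z)).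

HB.instance Definition _ (Z : topologicalType) :=
  Topological.copy (fell Z)
    (set_type ([set C : set Z | closed C] : set (fell_powerset Z))).

(* Partial maps are functions to [option Y], equal to [None] off the domain. *)
Definition pdom (X Y : Type) (f : X -> option Y) : set X := [set x | f x].

Definition pgraph (X Y : Type) (f : X -> option Y) : set (X * Y) :=
  [set p | f p.1 = Some p.2].

Definition fell_map (X Y : topologicalType) : Type :=
  set_type [set f : X -> option Y | closed (pgraph f)].

Definition fell_fun (X Y : topologicalType) (f : fell_map X Y) :
  X -> option Y := val f.
Coercion fell_fun : fell_map >-> Funclass.

Lemma fell_map_closed (X Y : topologicalType) (f : fell_map X Y) :
  pgraph f \in ([set C | closed C] : set (fell_powerset (X * Y)%type)).
Proof. by apply/mem_set; exact: (set_mem (valP f)). Qed.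

Definition fell_graph (X Y : topologicalType) (f : fell_map X Y) :
  fell (X * Y)%type := exist _ (pgraph f) (fell_map_closed f).

HB.instance Definition _ (X Y : topologicalType) :=
  Choice.copy (fell_map X Y)
    (set_type [set f : X -> option Y | closed (pgraph f)]).
HB.instance Definition _ (X Y : topologicalType) :=
  Topological.copy (fell_map X Y) (initial_topology (@fell_graph X Y)).

(* A choice of points [x_ i] in the domains of the [f_ i].  Finitely many of
   the domains may be empty, as the first terms of a convergent sequence are
   arbitrary; at those indices, and only there, [x_ i] is irrelevant. *)
Definition domain_selection (X Y : topologicalType) (f_ : nat -> fell_map X Y)
    (x_ : nat -> X) : Prop :=
  (\forall i \near \oo, pdom (f_ i) !=set0) /\
  (forall i, pdom (f_ i) !=set0 -> pdom (f_ i) (x_ i)).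

(* Main.v *)
(** In a Fell neighbourhood subbase, hitting open sets and missing compact sets
    decouple: for closed sets in a locally compact Hausdorff space the missing
    condition says that limits of points of subsequences lie in the limit set
    (test on a compact neighbourhood of a point off it), and, points having
    countable neighbourhood bases, the hitting condition says that every point
    of the limit set is a limit of a selection.  First countability also gives
    the converses, through convergent subsequences in compact sets.  Applied to
    graphs this is (a) and (b).  When Y is compact, (a) forces every cluster
    point of [f_(i_j) (x_j)] to be [f x], so that this sequence converges. *)

Require Import Defs.
From HB Require Import structures.
From mathcomp Require Import all_boot.
From mathcomp Require Import all_classical topology.

Set Implicit Arguments.
Unset Strict Implicit.
Unset Printing Implicit Defensive.

Local Open Scope classical_set_scope.

(** * Countable neighbourhood bases, subsequences and compact neighbourhoods *)

Section nested_base.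
Context {T : topologicalType}.

Definition nested_base (x : T) (U : nat -> set T) : Prop :=
  [/\ forall n, nbhs x (U n),
      forall m n, (m <= n)%N -> U n `<=` U m &
      forall A, nbhs x A -> exists n, U n `<=` A].

Lemma second_countable_nested_base (x : T) :
  @second_countable T -> exists U, nested_base x U.
Proof.
move=> [B cB [oB Bcvg]].
have cBx : countable [set V | B V /\ V x].
  by apply: sub_countable cB; apply: subset_card_le => V [].
move/pfcard_geP: cBx => [Bx0|[V]].
  have [V BVx _] := Bcvg x _ filterT.
  by have : set0 V by rewrite -Bx0.
(* [V] enumerates the basic open sets around [x]; intersecting its first [n.+1] members makes the
   base decreasing. *)
exists (fun n => [set t | forall k, (k <= n)%N -> V k t]); split.
- have Vnbhs k : nbhs x (V k).
    have [BV Vx] : [set V | B V /\ V x] (V k) by exact: funS.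
    by apply: open_nbhs_nbhs; split => //; exact: oB.
  elim=> [|n IHn].
    by apply: filterS (Vnbhs 0%N) => t V0t k; rewrite leqn0 => /eqP ->.
  apply: filterS2 IHn (Vnbhs n.+1) => t VIt VSt k.
  by rewrite leq_eqVlt => /predU1P[->//|]; rewrite ltnS; exact: VIt.
- by move=> m n mn t Vt k km; apply: Vt; exact: leq_trans mn.
- move=> A /Bcvg [W BWx WA].
  have [k _ VkW] : range V W by exact: (@surj _ _ _ _ V).
  by exists k => t Vt; apply: WA; rewrite -VkW; exact: Vt.
Qed.

End nested_base.

Lemma nested_base_setX (S T : topologicalType) (x : S) (y : T) U V :
  nested_base x U -> nested_base y V ->
  nested_base (x, y) (fun n => U n `*` V n).
Proof.
move=> [Ux Usub Ubase] [Vy Vsub Vbase]; split.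
- by move=> n; exists (U n, V n) => //; split => /=.
- by move=> m n mn [s t] [/= /(Usub _ _ mn) ? /(Vsub _ _ mn)].
- move=> A [[P Q] [/= /Ubase[m UP] /Vbase[n VQ]] PQA].
  exists (maxn m n) => -[s t] [/= Us Vt]; apply: PQA; split => /=.
    by apply: UP; apply: Usub Us; exact: leq_maxl.
  by apply: VQ; apply: Vsub Vt; exact: leq_maxr.
Qed.

Lemma increasing_cvgny (i_ : nat -> nat) :
  {homo i_ : j k / (j < k)%N} -> i_ @ \oo --> \oo.
Proof.
move=> i_incr A [N _ NA]; exists N => //= j Nj; apply: NA => /=.
apply: leq_trans Nj _; elim: j => // j IHj.
by apply: leq_ltn_trans IHj _; exact: i_incr.
Qed.

(** Each index is chosen beyond the previous one. [P] also depends on the position [j], so that the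
    [j]-th term can be asked to lie in the [j]-th neighbourhood of a base. *)
Lemma frequently_increasing (P : nat -> nat -> Prop) :
  (forall j N, exists2 i, (N <= i)%N & P j i) ->
  exists2 i_, {homo i_ : j k / (j < k)%N} & forall j, P j (i_ j).
Proof.
move=> freqP.
have /choice[s sP] : forall jN : nat * nat,
    exists i, (jN.2 <= i)%N /\ P jN.1 i.
  by move=> [j N]; have [i Ni Pji] := freqP j N; exists i.
pose i_ := fix i_ j := if j is k.+1 then s (j, (i_ k).+1) else s (0, 0)%N.
exists i_.
  by apply: homo_ltn => [|j]; [exact: ltn_trans|exact: (sP (_, _)).1].
by case=> [|j]; exact: (sP (_, _)).2.
Qed.

Lemma cluster_subsequence (T : topologicalType) (z : T) U (z_ : nat -> T) :
  nested_base z U -> cluster (z_ @ \oo) z ->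
  exists2 i_, {homo i_ : j k / (j < k)%N} & z_ \o i_ @ \oo --> z.
Proof.
move=> [Uz Usub Ubase] clz.
have [j N|i_ i_incr Ui] := @frequently_increasing (fun j i => U j (z_ i)).
  have [_ [[i Ni <-] Uj]] :
      [set z_ i | i in [set i | (N <= i)%N]] `&` U j !=set0.
    by apply: clz (Uz j); exists N => // i Ni; exists i.
  by exists i.
exists i_ => // A /Ubase[n UA]; exists n => // j nj.
by apply: UA; apply: Usub (Ui j).
Qed.

(** Local compactness gives one compact neighbourhood [V]; regularity at [x] gives a closed
    neighbourhood inside [A], and its intersection with [V] is still compact. *)
Lemma compact_nbhs_sub (T : topologicalType) (x : T) (A : set T) :
  locally_compact [set: T] -> hausdorff_space T -> nbhs x A ->
  exists K, [/\ nbhs x K, compact K & K `<=` A].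
Proof.
move=> lcT hT xA; have [V + [cV clV]] := lcT x I; rewrite withinET => xV.
have [W xW WA] := compact_regular hT cV xV xA.
exists (V `&` closure W); split; last by apply: subset_trans WA => t [].
- by apply: filterI => //; apply: filterS xW; exact: subset_closure.
- by apply: compact_closedI => //; exact: closed_closure.
Qed.

(** * Hitting and missing conditions as lower and upper Kuratowski limits *)

Section kuratowski_limits.
Context {Z : topologicalType}.
Variables (C_ : nat -> set Z) (C : set Z).

Definition hit_cvg : Prop := forall U, open U -> C `&` U !=set0 ->
  \forall i \near \oo, C_ i `&` U !=set0.

Definition miss_cvg : Prop := forall K, compact K -> C `&` K = set0 ->
  \forall i \near \oo, C_ i `&` K = set0.

Lemma miss_cvg_limsup (i_ : nat -> nat) (z_ : nat -> Z) (z : Z) :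
  closed C ->
  (forall A, nbhs z A -> exists K, [/\ nbhs z K, compact K & K `<=` A]) ->
  miss_cvg -> {homo i_ : j k / (j < k)%N} -> (forall j, C_ (i_ j) (z_ j)) ->
  z_ @ \oo --> z -> C z.
Proof.
move=> clC base_z missC i_incr Cz zcvg; apply: contrapT => nCz.
have [|K [zK cK KC]] := base_z (~` C).
  by apply: open_nbhs_nbhs; split => //; exact: closed_openC.
have CK0 : C `&` K = set0 by apply/disjoints_subset => t Ct /KC.
have {}missC : \forall j \near \oo, C_ (i_ j) `&` K = set0 :=
  increasing_cvgny i_incr (missC _ cK CK0).
have : \forall j \near \oo, K (z_ j) by exact: zcvg.
move=> /(filterI missC)/filter_ex[j [/= CiK0 Kz]].
by rewrite -[False]/(set0 (z_ j)) -CiK0.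
Qed.

(** If infinitely many [C_ i] met [K], points of these intersections would cluster in [K]; a further
    subsequence would converge to a point of both [C] and [K]. *)
Lemma limsup_miss_cvg :
  (forall z : Z, exists U, nested_base z U) ->
  (forall i_ z_ z, {homo i_ : j k / (j < k)%N} ->
    (forall j, C_ (i_ j) (z_ j)) -> z_ @ \oo --> z -> C z) ->
  miss_cvg.
Proof.
move=> baseZ limsupC K cK CK0; apply: contrapT => freqK.
have [j N|i_ i_incr CiK] :=
    @frequently_increasing (fun _ i => C_ i `&` K !=set0).
  apply: contrapT => noi; apply: freqK; exists N => // i Ni.
  by apply/eqP/negPn/negP => /set0P CiK; apply: noi; exists i.
have /choice[z_ zP] := CiK.
have [|z [Kz clz]] := cK (z_ @ \oo) _.
  by exists 0%N => // j _; exact: (zP j).2.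
have [U baseU] := baseZ z.
have [k_ k_incr zk] := cluster_subsequence baseU clz.
suff Cz : C z by rewrite -[False]/(set0 z) -CK0.
apply: (limsupC (i_ \o k_) (z_ \o k_)) zk.
  by move=> j l /k_incr/i_incr.
by move=> j; exact: (zP _).1.
Qed.

Lemma hit_cvg_liminf (z : Z) U : nested_base z U -> hit_cvg -> C z ->
  exists2 z_ : nat -> Z,
    forall i, C_ i !=set0 -> C_ i (z_ i) & z_ @ \oo --> z.
Proof.
move=> [Uz Usub Ubase] hitC Cz.
(* Choose a point of [C_ i] in the smallest of the first [n] neighbourhoods that [C_ i] meets. The
   bound [n] is there because [C_ i] may meet every [U m], leaving no smallest one; the diagonal
   [n = i] lets the bound grow. *)
have near_pt i n : exists w, (C_ i !=set0 -> C_ i w) /\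
    forall m, (m < n)%N -> C_ i `&` U m !=set0 -> U m w.
  elim: n => [|n [w [Cw Uw]]].
    by have [[w Cw]|nC] := pselect (C_ i !=set0); [exists w|exists z].
  have [[v [Cv Unv]]|nU] := pselect (C_ i `&` U n !=set0).
    by exists v; split => // m; rewrite ltnS => mn _; exact: Usub Unv.
  exists w; split => // m; rewrite ltnS leq_eqVlt => /predU1P[->//|].
  exact: Uw.
have /choice[z_ zP] := fun i => near_pt i i.
exists z_ => [i|A /Ubase[n UA]]; first exact: (zP i).1.
have {}hitC : \forall i \near \oo, C_ i `&` (U n)^° !=set0.
  by apply: hitC; [exact: open_interior|exists z; split => //; exact: Uz].
(* Once [i] exceeds [n], the neighbourhood [U n] is among those considered when choosing [z_ i]. *)
apply: filterS2 hitC (nbhs_infty_gt n) => i [w [Cw Uw]] ni; apply: UA.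
by apply: (zP i).2 => //; exists w; split => //; exact: interior_subset.
Qed.

Lemma liminf_hit_cvg :
  (forall z, C z -> exists2 z_ : nat -> Z,
    \forall i \near \oo, C_ i (z_ i) & z_ @ \oo --> z) ->
  hit_cvg.
Proof.
move=> liminfC U oU [z [/liminfC[z_ Cz zcvg] Uz]].
have : \forall i \near \oo, U (z_ i).
  by apply: zcvg; exact: open_nbhs_nbhs.
by apply: filterS2 Cz => i Cz Ui; exists (z_ i).
Qed.

End kuratowski_limits.

(** * Convergence in initial topologies, on subbases and in the Fell topology *)

Lemma initial_cvgP (S : choiceType) (T : topologicalType) (h : S -> T)
    (F : set_system S) (s : S) :
  Filter F -> F --> (s : initial_topology h) <-> h @ F --> h s.
Proof.
move=> FF; split=> [Fs A /initial_continuous hA|hFs A].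
  exact: Fs.
rewrite nbhsE => -[_ [[B oB <-] Bhs] BA].
apply: filterS BA _; apply: hFs; exact: open_nbhs_nbhs.
Qed.

(** Lets convergence be tested on a subbase, since filters are stable under finite intersections. *)
Lemma finI_from_filter (I : choiceType) (T : Type) (D : set I)
    (b : I -> set T) (F : set_system T) (x : T) (A : set T) :
  Filter F -> (forall i, D i -> b i x -> F (b i)) ->
  finI_from D b A -> A x -> F A.
Proof.
move=> FF Fb [E ED <-] Ex; apply: filter_bigI => i iE.
by apply: Fb; [exact/set_mem/ED|exact: Ex].
Qed.

Lemma lower_vietoris_cvgP (Z : topologicalType)
    (F : set_system (lower_vietoris Z)) (C : lower_vietoris Z) :
  Filter F -> F --> C <->
  forall U : set Z, open U -> C `&` U !=set0 -> F [set B | B `&` U !=set0].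
Proof.
move=> FF; split=> [FC U oU CU|FU A].
  apply: FC; apply: open_nbhs_nbhs; split => //.
  exists [set [set B | B `&` U !=set0]]; last by rewrite bigcup_set1.
  by move=> _ ->; exact: finI_from1.
rewrite nbhsE => -[_ [[D sD <-] [B DB BC]] DA].
apply: (filterS DA); apply: (@filterS _ _ _ B); first by move=> t ?; exists B.
by apply: finI_from_filter (sD _ DB) BC.
Qed.

Lemma upper_cocompact_cvgP (Z : topologicalType)
    (F : set_system (upper_cocompact Z)) (C : upper_cocompact Z) :
  Filter F -> F --> C <->
  forall K : set Z, compact K -> C `&` K = set0 -> F [set B | B `&` K = set0].
Proof.
move=> FF; split=> [FC K cK CK|FK A].
  apply: FC; apply: open_nbhs_nbhs; split => //.
  exists [set [set B | B `&` K = set0]]; last by rewrite bigcup_set1.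
  by move=> _ ->; exact: finI_from1.
rewrite nbhsE => -[_ [[D sD <-] [B DB BC]] DA].
apply: (filterS DA); apply: (@filterS _ _ _ B); first by move=> t ?; exists B.
by apply: finI_from_filter (sD _ DB) BC.
Qed.

(** The topology is pulled back twice, along the graph map and along the inclusion of closed sets;
    convergence in the join is convergence in both topologies. *)
Lemma fell_map_cvgP (X Y : topologicalType) (f_ : nat -> fell_map X Y)
    (f : fell_map X Y) :
  f_ @ \oo --> f <->
  hit_cvg (fun i => pgraph (f_ i)) (pgraph f) /\
  miss_cvg (fun i => pgraph (f_ i)) (pgraph f).
Proof.
have graphP : f_ @ \oo --> f <->
    (fun i => pgraph (f_ i)) @ \oo -->
      (pgraph f : fell_powerset (X * Y)%type).
  apply: iff_trans (initial_cvgP (@fell_graph X Y) f _) _.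
  exact: initial_cvgP.
apply: (iff_trans graphP); apply: iff_trans (cvg_sup _ _ _) _; split.
  move=> cvgf; split.
    exact: (lower_vietoris_cvgP _ _).1 (cvgf true).
  exact: (upper_cocompact_cvgP _ _).1 (cvgf false).
move=> [hitf missf] []; first exact/lower_vietoris_cvgP.
exact/upper_cocompact_cvgP.
Qed.

Lemma compact_unique_cluster_cvg (T : topologicalType) (F : set_system T)
    (y : T) :
  hausdorff_space T -> compact [set: T] -> ProperFilter F ->
  (forall z, cluster F z -> z = y) -> F --> y.
Proof.
move=> hT cT PF clFy; apply: (compact_cluster_set1 hT cT) => //.
- exact: filterT.
- exact: filterT.
- have [z [_ clz]] := cT F PF filterT.
  apply/seteqP; split => [w /clFy -> //|_ ->].
  by rewrite -(clFy _ clz).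
Qed.

(** * Limits of partial maps and of their domains *)

Section partial_map_limits.
Context {X Y : topologicalType}.
Variables (f_ : nat -> fell_map X Y) (f : fell_map X Y).

(** Condition (a). The equation with [Some] says at once that [x_ j] is in the domain and that
    [y_ j] is the value there. *)
Definition graph_limsup : Prop :=
  forall (i_ : nat -> nat) (x_ : nat -> X) (y_ : nat -> Y) (x : X) (y : Y),
    {homo i_ : j k / (j < k)%N} ->
    (forall j, f_ (i_ j) (x_ j) = Some (y_ j)) ->
    x_ @ \oo --> x -> y_ @ \oo --> y ->
    f x = Some y.

(** Condition (b). [y_ i] is free only at the finitely many indices with empty domain, which do not
    affect its limit. *)
Definition graph_liminf : Prop :=
  forall x : X, pdom f x ->
    exists (x_ : nat -> X) (y_ : nat -> Y),
      [/\ domain_selection f_ x_,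
          x_ @ \oo --> x,
          (forall i, pdom (f_ i) (x_ i) -> f_ i (x_ i) = Some (y_ i)) &
          exists y : Y, y_ @ \oo --> y].

Definition dom_limsup : Prop :=
  forall (i_ : nat -> nat) (x_ : nat -> X) (y_ : nat -> Y) (x : X),
    {homo i_ : j k / (j < k)%N} ->
    (forall j, f_ (i_ j) (x_ j) = Some (y_ j)) ->
    x_ @ \oo --> x ->
    exists2 y : Y, y_ @ \oo --> y & f x = Some y.

Definition dom_liminf : Prop :=
  forall x : X, pdom f x ->
    exists2 x_ : nat -> X, domain_selection f_ x_ & x_ @ \oo --> x.

Lemma pgraph_neq0 (g : fell_map X Y) : pgraph g !=set0 <-> pdom g !=set0.
Proof.
split=> [[[x y] gxy]|[x]]; first by exists x; rewrite /pdom/= gxy.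
by rewrite /pdom/=; case gx: (g x) => [y|//] _; exists (x, y).
Qed.

Lemma domain_selection_graph (x_ : nat -> X) (y_ : nat -> Y) :
  domain_selection f_ x_ ->
  (forall i, pdom (f_ i) (x_ i) -> f_ i (x_ i) = Some (y_ i)) ->
  \forall i \near \oo, f_ i (x_ i) = Some (y_ i).
Proof.
by move=> [dom0 sel] fxy; apply: filterS dom0 => i /sel/fxy.
Qed.

Lemma fell_cvg_graph_limits :
  (forall x : X, exists U, nested_base x U) ->
  (forall y : Y, exists V, nested_base y V) ->
  locally_compact [set: X] -> hausdorff_space X ->
  locally_compact [set: Y] -> hausdorff_space Y ->
  f_ @ \oo --> f -> graph_limsup /\ graph_liminf.
Proof.
move=> baseX baseY lcX hX lcY hY /fell_map_cvgP[hitf missf]; split.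
  move=> i_ x_ y_ x y i_incr fxy xcvg ycvg.
  have clf : closed (pgraph f) by exact: set_mem (valP f).
  have baseXY A : nbhs (x, y) A ->
      exists K, [/\ nbhs (x, y) K, compact K & K `<=` A].
    move=> [[P Q] [/= xP yQ] PQA].
    have [K [xK cK KP]] := compact_nbhs_sub lcX hX xP.
    have [L [yL cL LQ]] := compact_nbhs_sub lcY hY yQ.
    exists (K `*` L); split; [by exists (K, L)|exact: compact_setX|].
    by move=> t [/= /KP Pt /LQ Qt]; apply: PQA.
  apply: (@miss_cvg_limsup _ (fun i => pgraph (f_ i)) _ _
    (fun j => (x_ j, y_ j)) _ clf baseXY missf i_incr fxy).
  exact: (cvg_pair xcvg ycvg).
move=> x; rewrite /pdom/=; case fx: (f x) => [y|//] _.
have [[U baseU] [V baseV]] := (baseX x, baseY y).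
have [z_ z_graph zcvg] := hit_cvg_liminf
  (nested_base_setX baseU baseV) hitf (fx : pgraph f (x, y)).
exists (fst \o z_), (snd \o z_); split.
- split.
    (* Hitting the whole space makes all but finitely many graphs nonempty. *)
    have := hitf setT openT; case; first by exists (x, y).
    by move=> N _ hN; exists N => // i /hN; rewrite setIT => /pgraph_neq0.
  by move=> i /pgraph_neq0/z_graph; rewrite /pdom/= => ->.
- exact: cvg_comp zcvg cvg_fst.
- move=> i fi.
  by apply: z_graph; apply/pgraph_neq0; exists (z_ i).1.
- by exists y; exact: cvg_comp zcvg cvg_snd.
Qed.

Lemma graph_limits_fell_cvg :
  (forall x : X, exists U, nested_base x U) ->
  (forall y : Y, exists V, nested_base y V) ->
  graph_limsup -> graph_liminf -> f_ @ \oo --> f.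
Proof.
move=> baseX baseY supf inff; apply/fell_map_cvgP; split.
  apply: liminf_hit_cvg => -[x y] fxy.
  have [|x_ [y_ [sel xcvg fxy_ [y' ycvg]]]] := inff x.
    by rewrite /pdom/= [f x]fxy.
  have graph_xy := domain_selection_graph sel fxy_.
  exists (fun i => (x_ i, y_ i)) => //.
  have [N _ graphN] := graph_xy.
  (* Condition (b) does not name the limit of the values; (a), applied to the tail from [N] on,
     where all points are in the domains, identifies it. *)
  suff : f x = Some y'.
    by rewrite [f x]fxy => -[->]; exact: cvg_pair.
  apply: (supf (addn^~ N) (x_ \o addn^~ N) (y_ \o addn^~ N)).
  - by move=> j k; rewrite ltn_add2r.
  - by move=> j; apply: graphN; exact: leq_addl.
  - by apply: cvg_comp xcvg; exact: cvg_addnr.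
  - by apply: cvg_comp ycvg; exact: cvg_addnr.
apply: limsup_miss_cvg => [[x y]|i_ z_ [x y] i_incr fz zcvg].
  have [[U baseU] [V baseV]] := (baseX x, baseY y).
  by eexists; exact: nested_base_setX baseU baseV.
apply: (supf i_ (fst \o z_) (snd \o z_)) => //.
- exact: cvg_comp zcvg cvg_fst.
- exact: cvg_comp zcvg cvg_snd.
Qed.

Lemma graph_dom_limits :
  (forall y : Y, exists V, nested_base y V) -> hausdorff_space Y ->
  compact [set: Y] ->
  graph_limsup /\ graph_liminf <-> dom_limsup /\ dom_liminf.
Proof.
move=> baseY hY cY; split=> -[supf inff]; split.
- move=> i_ x_ y_ x i_incr fxy xcvg.
  (* Apply (a) along a subsequence whose values converge to the cluster point. *)
  have f_cluster y : cluster (y_ @ \oo) y -> f x = Some y.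
    have [V baseV] := baseY y.
    move=> /(cluster_subsequence baseV)[k_ k_incr ykcvg].
    apply: (supf (i_ \o k_) (x_ \o k_) (y_ \o k_)) => //.
    + by move=> j l /k_incr/i_incr.
    + by move=> j; exact: fxy.
    + exact: cvg_comp (increasing_cvgny k_incr) xcvg.
  have [y [_ cly]] := cY (y_ @ \oo) _ filterT.
  exists y; last exact: f_cluster.
  apply: compact_unique_cluster_cvg => // z /f_cluster.
  by rewrite (f_cluster _ cly) => -[].
- by move=> x /inff[x_ [y_ [sel xcvg _ _]]]; exists x_.
- move=> i_ x_ y_ x y i_incr fxy xcvg ycvg.
  have [y' y'cvg ->] := supf _ _ _ _ i_incr fxy xcvg.
  by congr Some; exact: (cvg_unique hY y'cvg ycvg).
- move=> x fx; have [x_ sel xcvg] := inff x fx.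
  (* A default value for [y_] at indices where [x_ i] is outside the domain; the value of [f] at [x]
     shows that [Y] is inhabited. *)
  have [y0 _] : exists y0, f x = Some y0.
    by move: fx; rewrite /pdom/=; case: (f x) => // y0; exists y0.
  pose y_ i := odflt y0 (f_ i (x_ i)).
  have fxy i : pdom (f_ i) (x_ i) -> f_ i (x_ i) = Some (y_ i).
    by rewrite /pdom/= /y_; case: (f_ i (x_ i)).
  exists x_, y_; split => //.
  have [N _ graphN] := domain_selection_graph sel fxy.
  have [|||y ycvg _] := supf (addn^~ N) (x_ \o addn^~ N) (y_ \o addn^~ N) x.
  + by move=> j k; rewrite ltn_add2r.
  + by move=> j; apply: graphN; exact: leq_addl.
  + by apply: cvg_comp xcvg; exact: cvg_addnr.
  (* Undo the shift by [N]: the index [i] is position [i - N] of the tail. *)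
  exists y => A /ycvg[M _ MA]; exists (M + N)%N => // i /= MNi.
  have Ni : (N <= i)%N by exact: leq_trans (leq_addl _ _) MNi.
  by rewrite -(subnK Ni); apply: MA; rewrite /= leq_subRL // addnC.
Qed.

End partial_map_limits.

Theorem theorem4p2 (X Y : topologicalType)
    (X_countable : @second_countable X) (X_lc : locally_compact [set: X])
    (X_hausdorff : hausdorff_space X)
    (Y_countable : @second_countable Y) (Y_lc : locally_compact [set: Y])
    (Y_hausdorff : hausdorff_space Y)
    (f_ : nat -> fell_map X Y) (f : fell_map X Y) :
  ((f_ @ \oo --> f) <->
    (forall (i_ : nat -> nat) (x_ : nat -> X) (y_ : nat -> Y) (x : X) (y : Y),
        {homo i_ : j k / (j < k)%N} ->
        (forall j, f_ (i_ j) (x_ j) = Some (y_ j)) ->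
        x_ @ \oo --> x -> y_ @ \oo --> y ->
        f x = Some y)
    /\
    (forall x : X, pdom f x ->
        exists (x_ : nat -> X) (y_ : nat -> Y),
          [/\ domain_selection f_ x_,
              x_ @ \oo --> x,
              (forall i, pdom (f_ i) (x_ i) -> f_ i (x_ i) = Some (y_ i)) &
              exists y : Y, y_ @ \oo --> y]))
  /\
  (compact [set: Y] ->
   ((f_ @ \oo --> f) <->
    (forall (i_ : nat -> nat) (x_ : nat -> X) (y_ : nat -> Y) (x : X),
        {homo i_ : j k / (j < k)%N} ->
        (forall j, f_ (i_ j) (x_ j) = Some (y_ j)) ->
        x_ @ \oo --> x ->
        exists2 y : Y, y_ @ \oo --> y & f x = Some y)
    /\
    (forall x : X, pdom f x ->
        exists2 x_ : nat -> X, domain_selection f_ x_ & x_ @ \oo --> x))).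
Proof.
have baseX (x : X) : exists U, nested_base x U.
  exact: second_countable_nested_base.
have baseY (y : Y) : exists V, nested_base y V.
  exact: second_countable_nested_base.
have graphP : f_ @ \oo --> f <-> graph_limsup f_ f /\ graph_liminf f_ f.
  split; first exact: fell_cvg_graph_limits.
  by case; exact: graph_limits_fell_cvg.
split=> // cY; apply: iff_trans graphP _; exact: graph_dom_limits.
Qed.
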